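(* Let $\bar M^{2m+1}(\phi,\xi,\eta,g)$ be a Lorentzian paracosymplectic manifold. Then there does not exist a non-trivial pointwise semi-slant warped product submanifold of the form $M=M_T\times_fM_\theta$ of $\bar M^{2m+1}$ such that the structure vector field $\xi$ is tangent to $M_\theta$.
   Context: A Lorentzian almost paracontact manifold $\bar M^{2m+1}(\phi,\xi,\eta,g)$ is a smooth $(2m+1)$-manifold with a $(1,1)$-tensor $\phi$, a vector field $\xi$, a $1$-form $\eta$ and a Lorentzian metric $g$ such that $\phi^2=I+\eta\otimes\xi$, $\eta(\xi)=-1$, $\phi\xi=0$, $\eta\circ\phi=0$, $\mathrm{rank}(\phi)=2m$, $g(\phi X,\phi Y)=g(X,Y)+\eta(X)\eta(Y)$; then $g(\xi,\xi)=-1$, $g(X,\xi)=\eta(X)$ and $g(\phi X,Y)=g(X,\phi Y)$. It is Lorentzian paracosymplectic if $\bar\nabla\eta=0$ and $\bar\nabla\Phi=0$, where $\bar\nabla$ is the Levi-Civita connection and $\Phi(X,Y)=g(X,\phi Y)$. Submanifolds $M$ are assumed to have non-degenerate induced metric, also denoted $g$. For $X$ tangent to $M$ write $\phi X=tX+nX$ with $tX$ tangent and $nX$ normal to $M$. Pointwise slant: a submanifold or distribution is pointwise slant if at each point $p$ the angle $\theta$ between $\phi X$ and the tangent space (resp. the distribution) does not depend on the non-zero vector $X$ (linearly independent of $\xi$) chosen at $p$; $\theta$, viewed as a function, is the slant function. For a distribution $\mathfrak D_\theta$ with orthogonal projection $P_\theta$ onto it, this is characterized by $(tP_\theta)^2Z=\cos^2\theta\,Z$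 for $Z\in\Gamma(\mathfrak D_\theta)$. A point is totally real if $\cos\theta=0$ there; a pointwise slant submanifold is pointwise proper slant if it contains no totally real points. A submanifold $M$ is pointwise semi-slant if $TM=\mathfrak D_T\oplus\mathfrak D_\theta\oplus\{\xi\}$ (orthogonal direct sum, $\{\xi\}$ the line distribution spanned by $\xi$, so $\xi$ is tangent to $M$) with $\phi(\mathfrak D_T)\subseteq\mathfrak D_T$ and $\mathfrak D_\theta$ pointwise slant with slant function $\theta$. The warped product $B\times_fF$ of pseudo-Riemannian manifolds $(B,g_B)$, $(F,g_F)$ with positive smooth warping function $f$ on $B$ is $B\times F$ with metric $g=g_B+f^2g_F$; it is trivial if $f$ is constant. A (non-trivial) pointwise semi-slant warped product submanifold $M_T\times_fM_\theta$ is a pointwise semi-slant submanifold that is a warped product of this form with $f$ non-constant on the first factor, where $M_T$ is an invariant integral submanifold of $\mathfrak D_T$ and $M_\theta$ is a pointwise proper slant integral submanifold of $\mathfrak D_\theta$. When $\xi$ is tangent to $M_\theta$, $M_\theta$ is an integral submanifold of $\mathfrak D_\theta\oplus\{\xi\}$.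
   Formalization: The first factor M_T is assumed connected; without this the claim fails, since f could take different constant values on different components of M_T. *)

(* Defs.v *)
From HB Require Import structures.
From mathcomp Require Import all_boot all_order all_algebra.
From mathcomp Require Import all_classical all_reals all_analysis.

Set Implicit Arguments.
Unset Strict Implicit.
Unset Printing Implicit Defensive.

Import Order.TTheory GRing.Theory Num.Theory.
Import numFieldNormedType.Exports.
Local Open Scope classical_set_scope.
Local Open Scope ring_scope.

(* Conventions. Vectors are rows, so linear maps and bilinear forms are matrices
   acting on the right: [v *m A], [u *m G *m v^T].  Subspaces of tangent spaces
   are row spaces of matrices (scope [%MS]). *)

Section SmoothMaps.
Variables (R : realType) (V W : normedModType R).

Fixpoint Ck (k : nat) (U : set V) (f : V -> W) : Prop :=
  if k is k'.+1 then
    (forall x, U x -> differentiable f x) /\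
    (forall v, Ck k' U (fun x => 'd f x v))
  else forall x, U x -> {for x, continuous f}.

(* Only used for open [U]. *)
Definition smooth_on (U : set V) (f : V -> W) : Prop := forall k, Ck k U f.

End SmoothMaps.

Section SmoothMapsTheory.
Variable R : realType.

Lemma near_eq_diff (V W : normedModType R) (f g : V -> W) (x : V) :
  (\forall y \near x, f y = g y) -> differentiable f x ->
  differentiable g x /\ 'd g x = 'd f x :> (V -> W).
Proof.
move=> fg df; have fgx : f x = g x by exact: nbhs_singleton fg.
have cf : continuous ('d f x) by exact: diff_continuous.
have E : g \o shift x = cst (g x) + 'd f x +o_ 0 id.
  apply/eqaddoP => e e0.
  have /eqaddoP/(_ e e0) := diff_locally df.
  have fg0 : \forall h \near (0 : V), f (h + x) = g (h + x).
    by move: fg; rewrite (near_shift 0) /= subr0; apply.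
  apply: filterS2 fg0 => h /= E.
  by rewrite !fctE /= E fgx.
have dg : 'd g x = 'd f x :> (V -> W) by exact: diff_unique.
split=> //; apply/diff_locallyP; rewrite dg; split=> //.
Qed.

Lemma Ck_ext (V W : normedModType R) k (U : set V) (f g : V -> W) :
  open U -> (forall x, U x -> f x = g x) -> Ck k U f -> Ck k U g.
Proof.
move=> oU; have near_fg (f' g' : V -> W) : (forall x, U x -> f' x = g' x) ->
    forall x, U x -> \forall y \near x, f' y = g' y.
  move=> fg x Ux; have Un : nbhs x U by exact: open_nbhs_nbhs.
  by apply: filterS Un => y /fg.
elim: k f g => [|k IH] f g fg /=.
  move=> fC x Ux; have : f @ x --> f x by exact: fC.
  rewrite (fg x Ux) => fx; suff : g @ x --> g x by [].
  apply: cvg_trans fx; apply: near_eq_cvg; exact: near_fg fg x Ux.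
case=> fD fC; split=> [x Ux|v].
  by have [] := near_eq_diff (near_fg _ _ fg x Ux) (fD x Ux).
apply: IH (fC v) => x Ux /=.
by have [_ ->] := near_eq_diff (near_fg _ _ fg x Ux) (fD x Ux).
Qed.

Lemma Ck_sub (V W : normedModType R) k (U U' : set V) (f : V -> W) :
  U `<=` U' -> Ck k U' f -> Ck k U f.
Proof.
move=> UU'; elim: k f => [|k IH] f /= fC; first by move=> x /UU'; exact: fC.
by case: fC => fD fC; split=> [x /UU'|v]; [exact: fD|exact: IH].
Qed.

Lemma for_comp (X Y Z : nbhsType) (f : X -> Y) (g : Y -> Z) (x : X) :
  {for x, continuous f} -> {for f x, continuous g} ->
  {for x, continuous (fun u => g (f u))}.
Proof. by move=> cf cg A /cg /cf. Qed.

Lemma mulmxr_continuous m n p (A : 'M[R]_(n, p)) :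
  continuous (fun v : 'M[R]_(m, n) => v *m A).
Proof.
move=> v; apply/(@cvgrPdist_lt _ _ _ (nbhs v)) => e e0.
pose C := 1 + \sum_i \sum_j `|A i j|.
have C0 : 0 < C by rewrite ltr_pwDl// sumr_ge0// => i _; rewrite sumr_ge0.
near=> w; rewrite -mulmxBl.
have : ball v (e / C) w by near: w; apply: nbhsx_ballx; rewrite divr_gt0.
rewrite -ball_normE /=; set d := v - w => dlt.
rewrite [ltLHS]/Num.Def.normr /= mx_normrE.
apply/bigmax_ltP; split=> //= -[i j] _ /=; rewrite mxE.
apply: le_lt_trans (ler_norm_sum _ _ _) _.
apply: (@le_lt_trans _ _ (`|d| * \sum_i \sum_j `|A i j|)).
  rewrite mulr_sumr; apply: ler_sum => l _; rewrite normrM.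
  apply: ler_pM => //; last first.
    by rewrite (bigD1 j)//= lerDl sumr_ge0.
  rewrite [leRHS]/Num.Def.normr /= mx_normrE.
  by apply: le_bigmax (fun ij : 'I_m * 'I_n => `|d ij.1 ij.2|) (i, l).
apply: (@le_lt_trans _ _ (`|d| * C)); first by rewrite ler_wpM2l// lerDr.
by rewrite -ltr_pdivlMr.
Unshelve. all: by end_near. Qed.

Lemma mulmxr_is_diff m n p (A : 'M[R]_(n, p)) (x : 'M[R]_(m, n)) :
  is_diff x (fun v : 'M[R]_(m, n) => v *m A) (fun v => v *m A).
Proof.
have -> : (fun v : 'M[R]_(m, n) => v *m A) = mulmxr A by [].
have c : continuous (mulmxr A : 'M[R]_(m, n) -> _) by exact: mulmxr_continuous.
by apply: DiffDef; [exact: linear_differentiable | rewrite diff_lin].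
Qed.

Lemma Ck_split k n1 n2 m m1 m2 (U1 : set 'rV[R]_n1) (U2 : set 'rV[R]_n2)
    (f : 'rV[R]_n1 -> 'rV[R]_m1) (g : 'rV[R]_n2 -> 'rV[R]_m2)
    (A1 : 'M[R]_(m, n1)) (A2 : 'M[R]_(m, n2)) p
    (B1 : 'M[R]_(m1, p)) (B2 : 'M[R]_(m2, p)) :
  open U1 -> open U2 -> Ck k U1 f -> Ck k U2 g ->
  Ck k [set u : 'rV[R]_m | U1 (u *m A1) /\ U2 (u *m A2)]
    (fun u => f (u *m A1) *m B1 + g (u *m A2) *m B2).
Proof.
move=> oU1 oU2.
elim: k f g => [|k IH] f g /=.
  move=> fC gC x [x1 x2].
  have a1 : {for x, continuous (fun u : 'rV[R]_m => f (u *m A1))}.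
    have cA : {for x, continuous (fun u : 'rV[R]_m => u *m A1)}.
      exact: mulmxr_continuous.
    exact: (@for_comp 'rV[R]_m 'rV[R]_n1 'rV[R]_m1 _ f x cA (fC _ x1)).
  have a2 : {for x, continuous (fun u : 'rV[R]_m => g (u *m A2))}.
    have cA : {for x, continuous (fun u : 'rV[R]_m => u *m A2)}.
      exact: mulmxr_continuous.
    exact: (@for_comp 'rV[R]_m 'rV[R]_n2 'rV[R]_m2 _ g x cA (gC _ x2)).
  have c1 := @for_comp 'rV[R]_m 'rV[R]_m1 'rV[R]_p _ _ x a1 (@mulmxr_continuous 1 _ _ B1 _).
  have c2 := @for_comp 'rV[R]_m 'rV[R]_m2 'rV[R]_p _ _ x a2 (@mulmxr_continuous 1 _ _ B2 _).
  exact: cvgD c1 c2.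
case=> fD fC [gD gC].
have D x : U1 (x *m A1) /\ U2 (x *m A2) ->
    is_diff x (fun u => f (u *m A1) *m B1 + g (u *m A2) *m B2)
     (fun v => 'd f (x *m A1) (v *m A1) *m B1 + 'd g (x *m A2) (v *m A2) *m B2).
  case=> x1 x2.
  have d1 := mulmxr_is_diff A1 x; have d2 := mulmxr_is_diff A2 x.
  have d3 := mulmxr_is_diff B1 (f (x *m A1)).
  have d4 := mulmxr_is_diff B2 (g (x *m A2)).
  have d5 := differentiableP (fD _ x1); have d6 := differentiableP (gD _ x2).
  have d7 := is_diff_comp d1 d5; have d8 := is_diff_comp d2 d6.
  have d9 := is_diff_comp d7 d3; have d10 := is_diff_comp d8 d4.
  exact: (is_diffD d9 d10).
split=> [x xU|v]; first exact: (@ex_diff _ _ _ _ _ _ _ (D x xU)).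
apply: Ck_ext (IH (fun x => 'd f x (v *m A1)) (fun x => 'd g x (v *m A2)) (fC _) (gC _)).
  apply: openI.
    by apply: open_comp oU1 => x _; exact: mulmxr_continuous.
  by apply: open_comp oU2 => x _; exact: mulmxr_continuous.
by move=> x xU /=; rewrite (@diff_val _ _ _ _ _ _ _ (D x xU)).
Qed.

End SmoothMapsTheory.

Record chart (R : realType) (M : topologicalType) (n : nat) := Chart {
  chart_dom : set M;
  chart_map :> M -> 'rV[R]_n;
  chart_inv : 'rV[R]_n -> M;
  chart_dom_open : open chart_dom;
  chart_img_open : open (chart_map @` chart_dom);
  chart_mapK : forall p, chart_dom p -> chart_inv (chart_map p) = p;
  chart_map_continuous : forall p, chart_dom p -> {for p, continuous chart_map};
  chart_inv_continuous :
    forall u, (chart_map @` chart_dom) u -> {for u, continuous chart_inv}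
}.

(* Besides an atlas, a manifold carries a choice of a chart [chart_at p] around
   each point [p].  The tangent space at [p] is 'rV[R]_n: a row stands for the
   tangent vector having these components in the chart [chart_at p]. *)
Record manifold (R : realType) (n : nat) := Manifold {
  space :> topologicalType;
  manifold_nonempty : [set: space] !=set0;
  manifold_hausdorff : hausdorff_space space;
  manifold_second_countable : @second_countable space;
  atlas : set (chart R space n);
  chart_at : space -> chart R space n;
  chart_at_atlas : forall p, atlas (chart_at p);
  chart_at_dom : forall p, chart_dom (chart_at p) p;
  chart_transition : forall c c', atlas c -> atlas c' ->
    smooth_on (c @` (chart_dom c `&` chart_dom c')) (c' \o chart_inv c)
}.

Arguments atlas {R n} m.

Section ProductManifold.
Variables (R : realType).

Lemma lsubmxE n1 n2 (u : 'rV[R]_(n1 + n2)) : lsubmx u = u *m col_mx 1%:M 0.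
Proof. by rewrite -[u in RHS]hsubmxK mul_row_col mulmx1 mulmx0 addr0. Qed.

Lemma rsubmxE n1 n2 (u : 'rV[R]_(n1 + n2)) : rsubmx u = u *m col_mx 0 1%:M.
Proof. by rewrite -[u in RHS]hsubmxK mul_row_col mulmx1 mulmx0 add0r. Qed.

Lemma row_mxE n1 n2 (u : 'rV[R]_n1) (v : 'rV[R]_n2) :
  row_mx u v = u *m row_mx 1%:M 0 + v *m row_mx 0 1%:M.
Proof. by rewrite !mul_mx_row add_row_mx !mulmx1 !mulmx0 addr0 add0r. Qed.

Lemma openX_prod (M N : topologicalType) (U : set M) (V : set N) :
  open U -> open V -> open (U `*` V : set (M * N)).
Proof.
move=> oU oV; rewrite openE => -[x y] [/= Ux Vy].
by exists (U, V) => //; split; apply: open_nbhs_nbhs.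
Qed.

Section ProdChart.
Variables (M N : topologicalType) (n k : nat).
Variables (c : chart R M n) (d : chart R N k).

Let dom : set (M * N) := chart_dom c `*` chart_dom d.
Let map (p : M * N) : 'rV[R]_(n + k) := row_mx (c p.1) (d p.2).
Let inv (u : 'rV[R]_(n + k)) : M * N :=
  (chart_inv c (lsubmx u), chart_inv d (rsubmx u)).

Lemma prod_dom_open : open dom.
Proof. by apply: openX_prod; exact: chart_dom_open. Qed.

Lemma prod_img (U : set M) (V : set N) : map @` (U `*` V) =
  [set u | (c @` U) (u *m col_mx 1%:M 0) /\ (d @` V) (u *m col_mx 0 1%:M)].
Proof.
apply/seteqP; split=> [_ [[p q] [/= Up Vq] <-]|u [[p Up pu] [q Vq qu]]].
  by rewrite /= -lsubmxE -rsubmxE row_mxKl row_mxKr; split; [exists p|exists q].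
by exists (p, q) => //; rewrite /map /= pu qu -lsubmxE -rsubmxE hsubmxK.
Qed.

Lemma prod_img_open : open (map @` dom).
Proof.
rewrite prod_img; apply: openI.
  apply: open_comp (@chart_img_open _ _ _ c) => x _; exact: mulmxr_continuous.
apply: open_comp (@chart_img_open _ _ _ d) => x _; exact: mulmxr_continuous.
Qed.

Lemma prod_mapK p : dom p -> inv (map p) = p.
Proof.
by case: p => p q [/= cp dq]; rewrite /inv/map row_mxKl row_mxKr /= !chart_mapK.
Qed.

Lemma prod_map_continuous p : dom p -> {for p, continuous map}.
Proof.
case: p => p q [/= cp dq].
have -> : map = fun p => c p.1 *m row_mx 1%:M 0 + d p.2 *m row_mx 0 1%:M.
  by apply/funext => x; rewrite /map row_mxE.
have a1 : {for (p, q), continuous (fun p : M * N => c p.1)}.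
  apply: (@for_comp _ _ _ fst c); first exact: cvg_fst.
  exact: chart_map_continuous.
have a2 : {for (p, q), continuous (fun p : M * N => d p.2)}.
  apply: (@for_comp _ _ _ snd d); first exact: cvg_snd.
  exact: chart_map_continuous.
have c1 := @for_comp (M * N)%type 'rV[R]_n 'rV[R]_(n + k) _ _ (p, q) a1
  (@mulmxr_continuous R 1 _ _ (row_mx 1%:M 0) _).
have c2 := @for_comp (M * N)%type 'rV[R]_k 'rV[R]_(n + k) _ _ (p, q) a2
  (@mulmxr_continuous R 1 _ _ (row_mx 0 1%:M) _).
exact: cvgD c1 c2.
Qed.

Lemma prod_inv_continuous u : (map @` dom) u -> {for u, continuous inv}.
Proof.
rewrite prod_img => -[/= u1 u2].
have -> : inv = fun u => (chart_inv c (u *m col_mx 1%:M 0),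
                          chart_inv d (u *m col_mx 0 1%:M)).
  by apply/funext => x; rewrite /inv lsubmxE rsubmxE.
have c1 := @for_comp 'rV[R]_(n + k) 'rV[R]_n M _ _ u
  (@mulmxr_continuous R 1 _ _ _ _) (chart_inv_continuous u1).
have c2 := @for_comp 'rV[R]_(n + k) 'rV[R]_k N _ _ u
  (@mulmxr_continuous R 1 _ _ _ _) (chart_inv_continuous u2).
exact: cvg_pair c1 c2.
Qed.

Definition prod_chart : chart R (M * N)%type (n + k) :=
  Chart prod_dom_open prod_img_open prod_mapK
        prod_map_continuous prod_inv_continuous.

End ProdChart.

Section ProdManifold.
Variables (n k : nat) (M : manifold R n) (N : manifold R k).

Let atl : set (chart R (M * N)%type (n + k)) :=
  [set prod_chart c d | c in atlas M & d in atlas N].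
Let at_ (p : M * N) := prod_chart (chart_at p.1) (chart_at p.2).

Lemma prod_nonempty : [set: (M * N)%type] !=set0.
Proof.
have [p _] := @manifold_nonempty _ _ M; have [q _] := @manifold_nonempty _ _ N.
by exists (p, q).
Qed.

Lemma prod_hausdorff : hausdorff_space (M * N)%type.
Proof.
move=> [p1 p2] [q1 q2] pq; congr pair.
  apply: (@manifold_hausdorff _ _ M) => A B Ap Bq.
  have [[x y] [/= ? ?]] : (A `*` setT) `&` (B `*` setT : set (M * N)) !=set0.
    apply: pq.
      by exists (A, setT) => //; split=> //; exact: filterT.
    by exists (B, setT) => //; split=> //; exact: filterT.
  by exists x; split; intuition.
apply: (@manifold_hausdorff _ _ N) => A B Ap Bq.
have [[x y] [/= ? ?]] : (setT `*` A) `&` (setT `*` B : set (M * N)) !=set0.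
  apply: pq.
    by exists (setT, A) => //; split=> //; exact: filterT.
  by exists (setT, B) => //; split=> //; exact: filterT.
by exists y; split; intuition.
Qed.

Lemma prod_second_countable : @second_countable (M * N)%type.
Proof.
have [B cB [oB bB]] := @manifold_second_countable _ _ M.
have [C cC [oC bC]] := @manifold_second_countable _ _ N.
exists [set U `*` V | U in B & V in C].
  have -> : [set U `*` V | U in B & V in C] =
      (fun UV : set M * set N => UV.1 `*` UV.2) @` (B `*` C).
    apply/seteqP; split=> [_ [U BU [V CV <-]]|_ [[U V] [/= BU CV] <-]].
      by exists (U, V).
    by exists U => //; exists V.
  exact: sub_countable (card_image_le _ _) (countableX cB cC).
split=> [_ [U BU [V CV <-]]|[p q] A].
  by apply: openX_prod; [exact: oB|exact: oC].
case=> [[A1 A2] [/= A1p A2q] A12].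
have [U [/= BU Up] UA] := bB p A1 A1p; have [V [/= CV Vq] VA] := bC q A2 A2q.
exists (U `*` V); first by split; [exists U => //; exists V|].
by move=> [x y] [/= /UA ? /VA ?]; apply: A12.
Qed.

Lemma prod_at_atlas p : atl (at_ p).
Proof.
by exists (chart_at p.1); [exact: chart_at_atlas|exists (chart_at p.2) => //;
  exact: chart_at_atlas].
Qed.

Lemma prod_at_dom p : chart_dom (at_ p) p.
Proof. by split; exact: chart_at_dom. Qed.

Lemma chart_imgI_open (T : topologicalType) l (c c' : chart R T l) :
  open (c @` (chart_dom c `&` chart_dom c')).
Proof.
have -> : c @` (chart_dom c `&` chart_dom c') =
    c @` chart_dom c `&` chart_inv c @^-1` chart_dom c'.
  apply/seteqP; split=> [_ [p [cp c'p] <-]|_ [[p cp <-]] /=].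
    by split; [exists p|rewrite /= chart_mapK].
  by rewrite chart_mapK// => c'p; exists p.
rewrite openE => u [uc uc'].
have nc : nbhs u (c @` chart_dom c).
  by apply: open_nbhs_nbhs; split => //; exact: chart_img_open.
have nc' : nbhs u (chart_inv c @^-1` chart_dom c').
  apply: (chart_inv_continuous uc); apply: open_nbhs_nbhs.
  by split => //; exact: chart_dom_open.
exact: filterI nc nc'.
Qed.

Lemma prod_transition c c' : atl c -> atl c' ->
  smooth_on (c @` (chart_dom c `&` chart_dom c')) (c' \o chart_inv c).
Proof.
move=> [c1 ac1 [c2 ac2 <-]] [d1 ad1 [d2 ad2 <-]] l /=.
have -> : (chart_dom c1 `*` chart_dom c2) `&` (chart_dom d1 `*` chart_dom d2) =
    (chart_dom c1 `&` chart_dom d1) `*` (chart_dom c2 `&` chart_dom d2).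
  by rewrite -setXI.
rewrite prod_img.
have -> : prod_chart d1 d2 \o
    (fun u => (chart_inv c1 (lsubmx u), chart_inv c2 (rsubmx u))) =
    fun u => (d1 \o chart_inv c1) (u *m col_mx 1%:M 0) *m row_mx 1%:M 0 +
             (d2 \o chart_inv c2) (u *m col_mx 0 1%:M) *m row_mx 0 1%:M.
  by apply/funext => u; rewrite /= lsubmxE rsubmxE row_mxE.
by apply: Ck_split; try exact: chart_imgI_open; exact: chart_transition.
Qed.

Definition prod_manifold : manifold R (n + k) :=
  Manifold prod_nonempty prod_hausdorff prod_second_countable
    prod_at_atlas prod_at_dom prod_transition.

End ProdManifold.
End ProductManifold.

Section Tensors.
Variables (R : realType) (n : nat) (M : manifold R n).

Definition smooth_fun (U : set M) (h : M -> R) : Prop :=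
  forall c, atlas M c ->
    smooth_on (c @` (U `&` chart_dom c)) (h \o chart_inv c).

(* Derivative of the function [h] along the tangent vector [v] at [p]. *)
Definition dfun (h : M -> R) (p : M) (v : 'rV[R]_n) : R :=
  'd (h \o chart_inv (chart_at p)) (chart_at p p) v.

(* Components in the chart [c] of the tangent vector [v] at [p]. *)
Definition chart_coord (c : chart R M n) (p : M) (v : 'rV[R]_n) : 'rV[R]_n :=
  v *m jacobian (c \o chart_inv (chart_at p)) (chart_at p p).

Definition chart_field (c : chart R M n) (X : M -> 'rV[R]_n) :
    'rV[R]_n -> 'rV[R]_n :=
  fun u => chart_coord c (chart_inv c u) (X (chart_inv c u)).

Definition smooth_field (U : set M) (X : M -> 'rV[R]_n) : Prop :=
  forall c, atlas M c ->
    smooth_on (c @` (U `&` chart_dom c)) (chart_field c X).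

Definition smooth_fun_near (p : M) (h : M -> R) : Prop :=
  exists2 U, open_nbhs p U & smooth_fun U h.

Definition smooth_field_near (p : M) (X : M -> 'rV[R]_n) : Prop :=
  exists2 U, open_nbhs p U & smooth_field U X.

(* [X, Y] = DY(X) - DX(Y), computed at [p] in the chart [chart_at p]. *)
Definition lie_bracket (X Y : M -> 'rV[R]_n) (p : M) : 'rV[R]_n :=
  let c := chart_at p in
  'd (chart_field c Y) (c p) (X p) - 'd (chart_field c X) (c p) (Y p).

Definition form (G : 'M[R]_n) (u v : 'rV[R]_n) : R := (u *m G *m v^T) 0 0.

Definition covec (a : 'cV[R]_n) (v : 'rV[R]_n) : R := (v *m a) 0 0.

Definition smooth_oneform (eta : M -> 'cV[R]_n) : Prop :=
  forall U X, open U -> smooth_field U X ->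
    smooth_fun U (fun p => covec (eta p) (X p)).

Definition smooth_endo (phi : M -> 'M[R]_n) : Prop :=
  forall U X, open U -> smooth_field U X ->
    smooth_field U (fun p => X p *m phi p).

Definition smooth_form (g : M -> 'M[R]_n) : Prop :=
  forall U X Y, open U -> smooth_field U X -> smooth_field U Y ->
    smooth_fun U (fun p => form (g p) (X p) (Y p)).

Definition pseudo_riemannian (g : M -> 'M[R]_n) : Prop :=
  smooth_form g /\ forall p, (g p)^T = g p /\ g p \in unitmx.

(* Signature (-, +, ..., +). *)
Definition lorentzian (g : M -> 'M[R]_n) : Prop :=
  pseudo_riemannian g /\
  forall p, exists2 P : 'M[R]_n, P \in unitmx &
    P *m g p *m P^T = diag_mx (\row_(i < n) (if i == 0%N :> nat then -1 else 1)).

(* [nabla p v Y] is the covariant derivative at [p] of the local vector field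
   [Y] along the tangent vector [v].  Vector fields are total functions, hence
   the restriction to fields smooth near [p], and the last clause, which says
   that [nabla p v Y] only depends on the germ of [Y] at [p]. *)
Definition covariant_derivative := M -> 'rV[R]_n -> (M -> 'rV[R]_n) -> 'rV[R]_n.

Record affine_connection (nabla : covariant_derivative) : Prop := {
  nabla_linear_dir : forall p a u v Y, smooth_field_near p Y ->
    nabla p (a *: u + v) Y = a *: nabla p u Y + nabla p v Y;
  nabla_add : forall p v Y Z, smooth_field_near p Y -> smooth_field_near p Z ->
    nabla p v (fun q => Y q + Z q) = nabla p v Y + nabla p v Z;
  nabla_leibniz : forall p v h Y, smooth_fun_near p h -> smooth_field_near p Y ->
    nabla p v (fun q => h q *: Y q) = dfun h p v *: Y p + h p *: nabla p v Y;
  nabla_smooth : forall U X Y, open U -> smooth_field U X -> smooth_field U Y ->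
    smooth_field U (fun p => nabla p (X p) Y);
  nabla_local : forall p v Y Z, smooth_field_near p Y ->
    (\forall q \near p, Y q = Z q) -> nabla p v Y = nabla p v Z
}.

Record levi_civita (g : M -> 'M[R]_n) (nabla : covariant_derivative) : Prop := {
  levi_civita_connection : affine_connection nabla;
  levi_civita_torsion : forall p X Y,
    smooth_field_near p X -> smooth_field_near p Y ->
    nabla p (X p) Y - nabla p (Y p) X = lie_bracket X Y p;
  levi_civita_metric : forall p v X Y,
    smooth_field_near p X -> smooth_field_near p Y ->
    dfun (fun q => form (g q) (X q) (Y q)) p v =
    form (g p) (nabla p v X) (Y p) + form (g p) (X p) (nabla p v Y)
}.

(* nabla eta = 0 *)
Definition parallel_oneform (nabla : covariant_derivative)
    (eta : M -> 'cV[R]_n) : Prop :=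
  forall p v Y, smooth_field_near p Y ->
    dfun (fun q => covec (eta q) (Y q)) p v - covec (eta p) (nabla p v Y) = 0.

(* nabla Phi = 0 *)
Definition parallel_form (nabla : covariant_derivative)
    (Phi : M -> 'M[R]_n) : Prop :=
  forall p v Y Z, smooth_field_near p Y -> smooth_field_near p Z ->
    dfun (fun q => form (Phi q) (Y q) (Z q)) p v
    - form (Phi p) (nabla p v Y) (Z p) - form (Phi p) (Y p) (nabla p v Z) = 0.

(* A distribution is given by its row spaces: locally, these are spanned by
   pointwise linearly independent smooth vector fields. *)
Definition distribution (D : M -> 'M[R]_n) : Prop :=
  exists r : nat, forall p, exists U (X : 'I_r -> M -> 'rV[R]_n),
    [/\ open_nbhs p U, forall i, smooth_field U (X i) &
      forall q, U q -> row_free (\matrix_i X i q) /\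
        (D q == \matrix_i X i q)%MS].

End Tensors.

Section Paracontact.
Variables (R : realType) (m : nat) (M : manifold R m.*2.+1).

Record lorentzian_almost_paracontact := LorentzianAlmostParacontact {
  phi : M -> 'M[R]_(m.*2.+1);
  xi : M -> 'rV[R]_(m.*2.+1);
  eta : M -> 'cV[R]_(m.*2.+1);
  metric : M -> 'M[R]_(m.*2.+1);
  phi_smooth : smooth_endo phi;
  xi_smooth : smooth_field setT xi;
  eta_smooth : smooth_oneform eta;
  metric_lorentzian : lorentzian metric;
  phi_sqr : forall p v, v *m phi p *m phi p = v + covec (eta p) v *: xi p;
  eta_xi : forall p, covec (eta p) (xi p) = -1;
  phi_xi : forall p, xi p *m phi p = 0;
  eta_phi : forall p v, covec (eta p) (v *m phi p) = 0;
  phi_rank : forall p, \rank (phi p) = m.*2;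
  metric_phi : forall p u v,
    form (metric p) (u *m phi p) (v *m phi p) =
    form (metric p) u v + covec (eta p) u * covec (eta p) v
}.

(* The matrix of Phi(X, Y) = g(X, phi Y). *)
Definition fundamental_form (S : lorentzian_almost_paracontact) (p : M) :
  'M[R]_(m.*2.+1) := metric S p *m (phi S p)^T.

Definition lorentzian_paracosymplectic (S : lorentzian_almost_paracontact) :=
  exists2 nabla : covariant_derivative M, levi_civita (metric S) nabla &
    parallel_oneform nabla (eta S) /\ parallel_form nabla (fundamental_form S).

End Paracontact.

Section Submanifolds.
Variable R : realType.

Definition smooth_map n k (N : manifold R n) (M : manifold R k)
    (F : N -> M) : Prop :=
  continuous F /\
  forall c d, atlas N c -> atlas M d ->
    smooth_on (c @` (chart_dom c `&` F @^-1` chart_dom d)) (d \o F \o chart_inv c).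

(* The differential of [F] at [p], from the tangent space at [p] to the tangent
   space at [F p]. *)
Definition dmap n k (N : manifold R n) (M : manifold R k)
    (F : N -> M) (p : N) : 'M[R]_(n, k) :=
  jacobian (chart_at (F p) \o F \o chart_inv (chart_at p)) (chart_at p p).

Definition immersion n k (N : manifold R n) (M : manifold R k)
    (F : N -> M) : Prop :=
  smooth_map F /\ forall p, row_free (dmap F p).

Definition pullback n k (N : manifold R n) (M : manifold R k)
    (F : N -> M) (g : M -> 'M[R]_k) (p : N) : 'M[R]_n :=
  dmap F p *m g (F p) *m (dmap F p)^T.

Definition nondegenerate_submanifold n k (N : manifold R n) (M : manifold R k)
    (g : M -> 'M[R]_k) (F : N -> M) : Prop :=
  immersion F /\ forall p, pullback F g p \in unitmx.

Definition orthogonal n k l (G : 'M[R]_n) (A : 'M[R]_(k, n)) (B : 'M[R]_(l, n)) :=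
  A *m G *m B^T = 0.

(* [theta] is the angle between the spacelike vector [w] and the subspace [A];
   [w'] is the orthogonal projection of [w] onto [A]. *)
Definition angle n k (G : 'M[R]_n) (w : 'rV[R]_n) (A : 'M[R]_(k, n)) (theta : R) :=
  [/\ 0 <= theta <= pi / 2, 0 < form G w w &
    exists w' : 'rV[R]_n, [/\ (w' <= A)%MS, orthogonal G (w - w') A &
      form G w' w' = cos theta ^+ 2 * form G w w]].

Section SemiSlant.
Variables (m : nat) (Mbar : manifold R m.*2.+1).
Variable S : lorentzian_almost_paracontact Mbar.

(* For a submanifold [iota : N -> Mbar], the distribution [D] on [N] is
   pointwise slant with slant function [theta]; tangent vectors of [N] are
   identified with their images in the tangent spaces of [Mbar]. *)
Definition pointwise_slant_distribution n (N : manifold R n) (iota : N -> Mbar)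
    (D : N -> 'M[R]_n) (theta : N -> R) : Prop :=
  forall p (X : 'rV[R]_(m.*2.+1)), (X <= D p *m dmap iota p)%MS ->
    row_free (col_mx X (xi S (iota p))) ->
    angle (metric S (iota p)) (X *m phi S (iota p)) (D p *m dmap iota p) (theta p).

Definition pointwise_slant_submanifold n (N : manifold R n) (iota : N -> Mbar)
    (theta : N -> R) : Prop :=
  nondegenerate_submanifold (metric S) iota /\
  pointwise_slant_distribution iota (fun=> 1%:M) theta.

Definition pointwise_proper_slant n (N : manifold R n) (iota : N -> Mbar)
    (theta : N -> R) : Prop :=
  pointwise_slant_submanifold iota theta /\ forall p, cos (theta p) != 0.

Definition invariant_submanifold n (N : manifold R n) (iota : N -> Mbar) : Prop :=
  nondegenerate_submanifold (metric S) iota /\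
  forall p, (dmap iota p *m phi S (iota p) <= dmap iota p)%MS.

Definition pointwise_semi_slant n (N : manifold R n) (iota : N -> Mbar)
    (DT Dth : N -> 'M[R]_n) (theta : N -> R) : Prop :=
  [/\ nondegenerate_submanifold (metric S) iota,
      distribution DT /\ distribution Dth,
      forall p, let d := dmap iota p in
        let T := DT p *m d in let Th := Dth p *m d in let x := xi S (iota p) in
        let G := metric S (iota p) in
        [/\ (T + Th + x == d)%MS, mxdirect (T + Th + x),
            orthogonal G T Th, orthogonal G T x & orthogonal G Th x],
      forall p, (DT p *m dmap iota p *m phi S (iota p) <= DT p *m dmap iota p)%MS &
      pointwise_slant_distribution iota Dth theta].

(* In the tangent space of [B * F] at [p], the first [b] coordinates are those
   of the tangent space of [B] and the last [k] those of [F]. *)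
Definition warped_metric b k (B : manifold R b) (F : manifold R k)
    (gB : B -> 'M[R]_b) (gF : F -> 'M[R]_k) (f : B -> R)
    (p : prod_manifold B F) : 'M[R]_(b + k) :=
  block_mx (gB p.1) 0 0 (f p.1 ^+ 2 *: gF p.2).

(* M_T x_f M_theta with xi tangent to M_theta; [B] is M_T and [F] is M_theta,
   which sit in [B * F] as the leaves [B * {x}] and [{y} * F].  The structure
   vector field being tangent to M_theta, the leaves [{y} * F] are integral
   submanifolds of D_theta + {xi}.  Connectedness of [B] makes a non-trivial
   warped product different from one whose warping function is merely locally
   constant. *)
Record semi_slant_warped_product_xi_tangent_fibre b k
    (B : manifold R b) (F : manifold R k)
    (gB : B -> 'M[R]_b) (gF : F -> 'M[R]_k) (f : B -> R)
    (iota : prod_manifold B F -> Mbar)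
    (DT Dth : prod_manifold B F -> 'M[R]_(b + k))
    (theta : prod_manifold B F -> R) : Prop := {
  base_connected : connected [set: B];
  base_metric : pseudo_riemannian gB;
  fibre_metric : pseudo_riemannian gF;
  warping_smooth : smooth_fun setT f;
  warping_gt0 : forall y, 0 < f y;
  total_semi_slant : pointwise_semi_slant iota DT Dth theta;
  total_metric : forall p, pullback iota (metric S) p = warped_metric gB gF f p;
  base_invariant : forall x : F, invariant_submanifold (fun y : B => iota (y, x));
  base_integral : forall (y : B) (x : F),
    (dmap (fun y : B => iota (y, x)) y ==
     DT (y, x) *m dmap iota (y, x))%MS;
  fibre_proper_slant : forall y : B,
    pointwise_proper_slant (fun x : F => iota (y, x)) (fun x => theta (y, x));
  fibre_integral : forall (y : B) (x : F),
    (dmap (fun x : F => iota (y, x)) x ==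
     Dth (y, x) *m dmap iota (y, x) + xi S (iota (y, x)))%MS;
  xi_tangent_fibre : forall (y : B) (x : F),
    (xi S (iota (y, x)) <= dmap (fun x : F => iota (y, x)) x)%MS
}.

Definition nontrivial_warping b (B : manifold R b) (f : B -> R) : Prop :=
  ~ exists r, forall y, f y = r.

End SemiSlant.
End Submanifolds.

(* Main.v *)
From HB Require Import structures.
Require Import Defs.
From mathcomp Require Import all_boot all_order all_algebra.
From mathcomp Require Import all_classical all_reals all_analysis.
From mathcomp Require Import ring.

(** The structure form eta is closed, and this forces the warping function to be
    constant.

    Since the Levi-Civita connection is torsion free and eta is parallel,
    d eta = 0 ([parallel_oneform_closed]).  Pull eta back to M = B x F along the
    immersion.  Because eta(X) = g(X, xi) and xi, being tangent to the fibres, is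
    orthogonal to the leaves B x {x}, the pulled back form alpha kills the base
    directions.  A closed form without base component has fibre components that
    do not depend on the base point: for each x in F, the covector alpha_(y, x)
    on the tangent space of F at x is locally constant in y
    ([fibre_pullback_locally_constant]).

    On the other hand, write xi = (0, zeta) at (y, x).  The warped metric gives
    alpha = f(y)^2 g_F(zeta, .), hence
      -1 = eta(xi) = alpha(zeta) = f(y)^-2 g_F^-1(alpha, alpha),
    that is f(y)^2 = - g_F^-1(alpha_(y, x), alpha_(y, x)).  With x fixed, the
    right-hand side is locally constant in y, so the positive function f is
    locally constant, hence constant on the connected base.

    The analytic input is the commutation of d with pullbacks
    ([pullback_closed]), whose only non-formal ingredient is the symmetry of
    second derivatives ([schwarz]).  Tangent vectors at a point q are rows of
    components in the chart chosen at q, a chart that varies with q; to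
    differentiate, everything is expressed in one fixed chart by means of its
    coordinate fields ([coord_field], [coord_field_dmap]). *)

Set Implicit Arguments.
Unset Strict Implicit.
Unset Printing Implicit Defensive.

Import Order.TTheory GRing.Theory Num.Theory.
Import numFieldNormedType.Exports.
Local Open Scope classical_set_scope.
Local Open Scope ring_scope.

(** * Calculus of k times differentiable maps *)

Section CkCalculus.
Variable R : realType.
Implicit Types V W : normedModType R.

Lemma scale_is_bilinear W :
  bilinear_for
    (GRing.Scale.Law.clone _ _ *:%R _) (GRing.Scale.Law.clone _ _ *:%R _)
    (@GRing.scale R W : R^o -> W -> W).
Proof.
split=> [u|u] a x y /=.
- by rewrite scalerDl -scalerA.
- by rewrite scalerDr !scalerA [u * a]mulrC.
Qed.

HB.instance Definition _ (W : normedModType R) :=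
  bilinear_isBilinear.Build R R W W _ _ (@GRing.scale R W : R^o -> W -> W)
    (scale_is_bilinear W).

Lemma is_diff_scale V W (h dh : V -> R) (f df : V -> W) x :
  is_diff x h dh -> is_diff x f df ->
  is_diff x (fun u => h u *: f u) (fun v => h x *: df v + dh v *: f x).
Proof.
move=> dhx dfx.
have c : continuous (fun p : R^o * W => p.1 *: p.2).
  by move=> p; exact: scale_continuous.
have D : is_diff (h x, f x) (fun p : R^o * W => p.1 *: p.2)
    (fun q : R^o * W => h x *: q.2 + q.1 *: f x).
  apply: DiffDef.
    exact: (@differentiable_bilin _ _ _ _ (@GRing.scale R W : R^o -> W -> W) _ c).
  by rewrite (@diff_bilin _ _ _ _ (@GRing.scale R W : R^o -> W -> W) _ c).
exact: (is_diff_comp (is_diff_pair dhx dfx) D).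
Qed.

Lemma Ck_pred V W k (U : set V) (f : V -> W) : Ck k.+1 U f -> Ck k U f.
Proof.
elim: k f => [|k IH] f /= [fD fC]; last by split=> // v; apply: IH.
by move=> x Ux; apply: differentiable_continuous; exact: fD.
Qed.

Lemma Ck_add V W k (U : set V) (f g : V -> W) : open U ->
  Ck k U f -> Ck k U g -> Ck k U (fun x => f x + g x).
Proof.
move=> oU; elim: k f g => [|k IH] f g /=.
  by move=> fC gC x Ux; apply: cvgD; [exact: fC|exact: gC].
move=> [fD fC] [gD gC].
have D x : U x -> is_diff x (fun y => f y + g y) (fun v => 'd f x v + 'd g x v).
  move=> Ux; exact: (is_diffD (differentiableP (fD x Ux)) (differentiableP (gD x Ux))).
split=> [x Ux|v]; first exact: (@ex_diff _ _ _ _ _ _ _ (D x Ux)).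
apply: Ck_ext (IH _ _ (fC v) (gC v)) => // x Ux.
by rewrite (@diff_val _ _ _ _ _ _ _ (D x Ux)).
Qed.

Lemma Ck_cst V W k (U : set V) (a : W) : open U -> Ck k U (fun=> a).
Proof.
move=> oU; elim: k a => [|k IH] a /=; first by move=> x _; exact: cvg_cst.
split=> [x _|v]; first exact: differentiable_cst.
by apply: Ck_ext (IH 0) => // x _; rewrite (diff_cst a).
Qed.

Lemma Ck_sum V W k (U : set V) n (f : 'I_n -> V -> W) : open U ->
  (forall i, Ck k U (f i)) -> Ck k U (fun x => \sum_i f i x).
Proof.
move=> oU; elim: n f => [|n IH] f fC.
  by apply: Ck_ext (Ck_cst k 0 oU) => // x _; rewrite big_ord0.
apply: (@Ck_ext _ _ _ _ _ (fun x => \sum_i f (widen_ord (leqnSn n) i) x + f ord_max x)) => //.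
  by move=> x _; rewrite big_ord_recr.
by apply: Ck_add => //; apply: IH => i.
Qed.

Lemma Ck_scale V W k (U : set V) (h : V -> R) (f : V -> W) : open U ->
  Ck k U h -> Ck k U f -> Ck k U (fun x => h x *: f x).
Proof.
move=> oU; elim: k h f => [|k IH] h f.
  by move=> /= hC fC x Ux; apply: cvgZ; [exact: hC|exact: fC].
move=> hf ff; have [hD hC] := hf; have [fD fC] := ff.
have D x : U x -> is_diff x (fun y => h y *: f y)
    (fun v => h x *: 'd f x v + 'd h x v *: f x).
  by move=> Ux; apply: is_diff_scale; apply: differentiableP; [exact: hD|exact: fD].
split=> [x Ux|v]; first exact: (@ex_diff _ _ _ _ _ _ _ (D x Ux)).
have C1 := IH _ _ (Ck_pred hf) (fC v); have C2 := IH _ _ (hC v) (Ck_pred ff).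
apply: Ck_ext (Ck_add oU C1 C2) => // x Ux.
by rewrite (@diff_val _ _ _ _ _ _ _ (D x Ux)).
Qed.

Lemma is_diff_coord V n (f df : V -> 'rV[R]_n) x j : is_diff x f df ->
  is_diff x (fun y => f y 0 j) (fun v => df v 0 j).
Proof.
move=> dfx; have @l : {linear 'rV[R]_n -> R}.
  by exists (fun N : 'rV[R]_n => N 0 j); do 2![eexists]; do ?[constructor];
     rewrite ?mxE// => ? *; rewrite ?mxE//; move=> ?; rewrite !mxE.
have cl : continuous l by exact: coord_continuous.
have D : is_diff (f x) l l.
  by apply: DiffDef; [exact: linear_differentiable|rewrite diff_lin].
exact: (is_diff_comp dfx D).
Qed.

Lemma Ck_coord V n k (U : set V) (f : V -> 'rV[R]_n) j : open U ->
  Ck k U f -> Ck k U (fun x => f x 0 j).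
Proof.
move=> oU; elim: k f => [|k IH] f /=.
  move=> fC x Ux.
  apply: (@for_comp _ _ _ f (fun r : 'rV[R]_n => r 0 j)); first exact: fC.
  exact: coord_continuous.
move=> [fD fC].
have D x (Ux : U x) := is_diff_coord j (differentiableP (fD x Ux)).
split=> [x Ux|v]; first exact: (@ex_diff _ _ _ _ _ _ _ (D x Ux)).
apply: Ck_ext (IH _ (fC v)) => // x Ux.
by rewrite (@diff_val _ _ _ _ _ _ _ (D x Ux)).
Qed.

(** The derivative of the composite in a fixed direction evaluates the derivative
    of the outer map in a direction that varies with the point.  As [Ck] speaks
    of fixed directions only, that derivative is expanded along the basis
    vectors; this is why the intermediate space is a space of rows. *)
Lemma Ck_comp V W n k (U : set V) (U' : set 'rV[R]_n) (f : V -> 'rV[R]_n)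
    (g : 'rV[R]_n -> W) : open U -> open U' -> (forall x, U x -> U' (f x)) ->
  Ck k U f -> Ck k U' g -> Ck k U (g \o f).
Proof.
move=> oU oU' fU; elim: k f g fU => [|k IH] f g fU.
  by move=> /= fC gC x Ux; apply: for_comp; [exact: fC|exact/gC/fU].
move=> ff gg; have [fD fC] := ff; have [gD gC] := gg.
have D x : U x -> is_diff x (g \o f) (fun v => 'd g (f x) ('d f x v)).
  move=> Ux.
  exact: (is_diff_comp (differentiableP (fD x Ux)) (differentiableP (gD _ (fU _ Ux)))).
split=> [x Ux|v]; first exact: (@ex_diff _ _ _ _ _ _ _ (D x Ux)).
have C j : Ck k U (fun x => ('d f x v) 0 j *: 'd g (f x) (delta_mx 0 j)).
  apply: Ck_scale => //; first exact: Ck_coord (fC v).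
  exact: (IH f (fun z => 'd g z (delta_mx 0 j)) fU (Ck_pred ff) (gC _)).
apply: Ck_ext (Ck_sum oU C) => // x Ux.
rewrite (@diff_val _ _ _ _ _ _ _ (D x Ux)) [in RHS](row_sum_delta ('d f x v)) linear_sum.
by apply: eq_bigr => j _; rewrite linearZ.
Qed.

(** * Mean values and symmetry of second derivatives *)

Lemma mean_value V (h : V -> R) x v :
  (forall t : R, 0 <= t <= 1 -> differentiable h (x + t *: v)) ->
  exists2 t : R, 0 <= t <= 1 & h (x + v) - h x = 'd h (x + t *: v) v.
Proof.
move=> dh; pose l (t : R) := x + t *: v.
have dl (t : R) : is_diff t (l : R -> V) (fun s => s *: v).
  have -> : (fun s : R => s *: v) = 0 + (fun s : R => s *: v) :> (R -> V).
    by apply/funext => s; rewrite /GRing.add /= add0r.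
  exact: (@is_diffD _ _ _ (cst x) (fun s : R => s *: v) _ _ t).
have D (t : R) : 0 <= t <= 1 -> is_derive t 1 (h \o l) ('d h (l t) v).
  move=> t01; have Dt := is_diff_comp (dl t) (differentiableP (dh t t01)).
  apply: DeriveDef; first by apply: diff_derivable; exact: ex_diff.
  by rewrite deriveE ?(@ex_diff _ _ _ _ _ _ _ Dt)// (@diff_val _ _ _ _ _ _ _ Dt) /= scale1r.
have C : {within `[0, 1], continuous (h \o l)}.
  by apply: derivable_within_continuous => t; rewrite in_itv /= => /D [].
have D' (t : R) : t \in `]0, 1[ -> is_derive t 1 (h \o l) ('d h (l t) v).
  by rewrite in_itv /= => /andP[t0 t1]; apply: D; rewrite !ltW.
have [t t01 E] := MVT_segment ler01 D' C.
exists t; first by move: t01; rewrite in_itv.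
by move: E; rewrite /= /l scale1r scale0r addr0 subr0 mulr1.
Qed.


Lemma constant_of_diff0 V (h : V -> R) (U : set V) x : open U -> U x ->
  (forall y, U y -> differentiable h y) -> (forall y v, U y -> 'd h y v = 0) ->
  \forall y \near x, h y = h x.
Proof.
move=> oU Ux hD h0.
have /nbhs_ballP[e /= e0 eU] : nbhs x U by exact: open_nbhs_nbhs.
apply/nbhs_ballP; exists e => //= y xy.
have xU (t : R) : 0 <= t <= 1 -> U (x + t *: (y - x)).
  case/andP=> t0 t1; apply: eU; move: xy; rewrite -!ball_normE /=.
  rewrite opprD addNKr normrN normrZ (ger0_norm t0) distrC; apply: le_lt_trans.
  by rewrite ler_piMl.
have [t t01] := mean_value (fun t t01 => hD _ (xU t t01)).
by rewrite [x + (y - x)]addrC subrK h0; [move/eqP; rewrite subr_eq0 => /eqP|exact: xU].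
Qed.

(** The second difference is a first difference of y |-> h(y + w) - h(y), so two
    mean value steps turn it into a second derivative at some point of the
    parallelogram spanned by [v] and [w]. *)
Lemma second_difference V (h : V -> R) (U : set V) x v w : Ck 2 U h ->
  (forall s t : R, 0 <= s <= 1 -> 0 <= t <= 1 -> U (x + s *: v + t *: w)) ->
  exists s t : R, [/\ 0 <= s <= 1, 0 <= t <= 1 &
    h (x + v + w) - h (x + v) - h (x + w) + h x =
    'd (fun y => 'd h y v) (x + s *: v + t *: w) w].
Proof.
move=> [hD hC] inU; have [kD _] := hC v.
have inU0 (s : R) : 0 <= s <= 1 -> U (x + s *: v).
  by move=> s01; have := inU s 0 s01; rewrite lexx ler01 scale0r addr0; exact.
have inU1 (s : R) : 0 <= s <= 1 -> U (x + s *: v + w).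
  by move=> s01; have := inU s 1 s01; rewrite lexx ler01 scale1r; exact.
have D y : U y -> U (y + w) -> is_diff y (fun y => h (y + w) - h y)
    (fun u => 'd h (y + w) u - 'd h y u).
  move=> Uy Uyw.
  have dw : is_diff y (fun y : V => y + w) id.
    have -> : id = id + 0 :> (V -> V) by apply/funext => u; rewrite /GRing.add /= addr0.
    exact: (@is_diffD _ _ _ id (cst w)).
  have d1 : is_diff y (fun y => h (y + w)) ('d h (y + w)).
    exact: (is_diff_comp dw (differentiableP (hD _ Uyw))).
  exact: (is_diffB d1 (differentiableP (hD _ Uy))).
have [s s01 E] := @mean_value V (fun y => h (y + w) - h y) x v
  (fun s s01 => @ex_diff _ _ _ _ _ _ _ (D _ (inU0 s s01) (inU1 s s01))).
have [t t01 E'] := @mean_value V (fun y => 'd h y v) (x + s *: v) w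
  (fun t t01 => kD _ (inU s t s01 t01)).
exists s, t; split=> //; rewrite -E'.
have := @diff_val _ _ _ _ _ _ _ (D _ (inU0 s s01) (inU1 s s01)).
move=> /(congr1 (fun l => l v)) <-; rewrite -E.
by rewrite opprB addrA addrAC.
Qed.

(** The second difference is symmetric in the two directions: over every
    parallelogram of sides [s *: v] and [s *: w] both mixed second derivatives
    take a common value, possibly at different points, and these points tend
    to [x] with [s]. *)
Lemma schwarz V (h : V -> R) (U : set V) x v w : open U -> U x -> Ck 2 U h ->
  'd (fun y => 'd h y v) x w = 'd (fun y => 'd h y w) x v.
Proof.
move=> oU Ux hC; have [hD hC'] := hC.
pose F v w y := 'd (fun y => 'd h y v) y w.
have Fc v' w' : {for x, continuous (F v' w')}.
  by have [_ /(_ w')] := hC' v'; apply.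
have FZ v' w' (s : R) y : U y -> F (s *: v') (s *: w') y = s * s * F v' w' y.
  move=> Uy; rewrite /F; have [kD _] := hC' v'.
  have -> : (fun y => 'd h y (s *: v')) = s *: (fun y => 'd h y v').
    by apply/funext => z; rewrite linearZ.
  rewrite linearZ diffZ /=; last exact: kD.
  by rewrite -[in RHS]mulrA.
apply/eqP; rewrite -subr_eq0 -normr_le0; apply/ler_addgt0Pl => e e0; rewrite addr0.
have e20 : 0 < e / 2 by rewrite divr_gt0.
have near_F v' w' : \forall y \near x, `|F v' w' x - F v' w' y| < e / 2.
  by apply: (@cvgr_dist_lt _ _ _ (nbhs x) _ (F v' w') (F v' w' x)) => //; exact: Fc.
have nU : nbhs x U by exact: open_nbhs_nbhs.
have nb : nbhs x (U `&` ([set y | `|F v w x - F v w y| < e / 2] `&`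
    [set y | `|F w v x - F w v y| < e / 2])).
  by apply: filterI nU _; apply: filterI; exact: near_F.
have /nbhs_ballP[r /= r0 rU] := nb.
pose C := `|v| + `|w| + 1; have C0 : 0 < C by rewrite ltr_wpDl// addr_ge0.
(* [s] is so small that the parallelogram stays in the ball of radius [r] *)
have [s s0 sC] : exists2 s : R, 0 < s & s * C = r.
  by exists (r / C); [rewrite divr_gt0|rewrite divfK// gt_eqF].
have inb (a b : R) : 0 <= a <= 1 -> 0 <= b <= 1 ->
    ball x r (x + a *: (s *: v) + b *: (s *: w)).
  case/andP=> a0 a1 /andP[b0 b1]; rewrite -ball_normE /= -addrA opprD addNKr normrN.
  apply: le_lt_trans (ler_normD _ _) _.
  rewrite !normrZ (ger0_norm a0) (ger0_norm b0) (ger0_norm (ltW s0)).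
  apply: (@le_lt_trans _ _ (s * (`|v| + `|w|))).
    rewrite mulrDr; apply: lerD; apply: ler_piMl => //.
      by apply: mulr_ge0 => //; exact: ltW s0.
    by apply: mulr_ge0 => //; exact: ltW s0.
  by rewrite -sC ltr_pM2l// ltrDl ltr01.
have inbU : forall a b : R, 0 <= a <= 1 -> 0 <= b <= 1 ->
    U (x + a *: (s *: v) + b *: (s *: w)).
  by move=> a b a01 b01; have [] := rU _ (inb a b a01 b01).
have inbU' : forall a b : R, 0 <= a <= 1 -> 0 <= b <= 1 ->
    U (x + a *: (s *: w) + b *: (s *: v)).
  by move=> a b a01 b01; rewrite addrAC; exact: inbU.
have [a [b [a01 b01 E]]] := second_difference hC inbU.
have [a' [b' [a01' b01' E']]] := second_difference hC inbU'.
have [/= U1 [N1 _]] := rU _ (inb a b a01 b01).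
have [/= U2 [_ N2]] := rU _ (inb b' a' b01' a01').
move: E E'; rewrite -![ 'd (fun y => _) _ _ ]/(F _ _ _).
rewrite (addrAC x (a' *: _)) !FZ// => E E'.
have ss0 : s * s != 0 by rewrite mulf_neq0// gt_eqF.
have EE : F v w (x + a *: (s *: v) + b *: (s *: w)) =
          F w v (x + b' *: (s *: v) + a' *: (s *: w)).
  apply: (mulfI ss0); rewrite -E -E' [x + s *: w + _]addrAC.
  ring.
move: N1 N2; rewrite EE -/(F v w x) -/(F w v x).
set z := F w v _ => N1 N2.
have -> : F v w x - F w v x = (F v w x - z) - (F w v x - z) by ring.
by rewrite (le_trans (ler_normB _ _))// [leRHS]splitr lerD// ltW.
Qed.

End CkCalculus.

(** * Pullback of a closed one-form *)

Section PullbackOneForm.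
Variable R : realType.
Implicit Types V W : normedModType R.

Lemma is_diff_sum V W n (f df : 'I_n -> V -> W) x :
  (forall i, is_diff x (f i) (df i)) ->
  is_diff x (fun y => \sum_i f i y) (fun v => \sum_i df i v).
Proof.
elim: n f df => [|n IH] f df fD.
  have -> : (fun y => \sum_(i < 0) f i y) = cst 0 by apply/funext => y; rewrite big_ord0.
  have -> : (fun y => \sum_(i < 0) df i y) = 0 by apply/funext => y; rewrite big_ord0.
  exact: is_diff_cst.
have -> : (fun y => \sum_i f i y) =
    (fun y => \sum_i f (widen_ord (leqnSn n) i) y) + f ord_max.
  by apply/funext => y; rewrite big_ord_recr.
have -> : (fun y => \sum_i df i y) =
    (fun y => \sum_i df (widen_ord (leqnSn n) i) y) + df ord_max.
  by apply/funext => y; rewrite big_ord_recr.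
by apply: is_diffD; apply: IH.
Qed.

(** [H v] is the component along [v] of a one-form on 'rV_n that is closed at
    [f x], and y |-> [H ('d f y a) (f y)] is the component along [a] of its
    pullback.  In the derivative of the latter along [b], the terms
    differentiating [H] are symmetric in [a] and [b] because the form is closed,
    and those differentiating ['d f] by Schwarz. *)
Lemma pullback_closed V n (U : set V) (f : V -> 'rV[R]_n)
    (H : 'rV[R]_n -> 'rV[R]_n -> R) x : open U -> U x -> Ck 2 U f ->
  (forall v z, H v z = \sum_j v 0 j *: H (delta_mx 0 j) z) ->
  (forall v, differentiable (H v) (f x)) ->
  (forall v w, 'd (H v) (f x) w = 'd (H w) (f x) v) ->
  (forall a, differentiable (fun y => H ('d f y a) (f y)) x) /\
  forall a b, 'd (fun y => H ('d f y a) (f y)) x b =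
              'd (fun y => H ('d f y b) (f y)) x a.
Proof.
move=> oU Ux fC HE HD Hsym; have [fD fC'] := fC.
have fx := differentiableP (fD x Ux).
have dH v : 'd (H v) (f x) =
    (fun w => \sum_j v 0 j *: 'd (H (delta_mx 0 j)) (f x) w) :> (_ -> _).
  have D := is_diff_sum (fun j => is_diffZ (v 0 j) (differentiableP (HD (delta_mx 0 j)))).
  rewrite -(@diff_val _ _ _ _ _ _ _ D); congr (diff _ _ : _ -> _).
  by apply/funext => z; rewrite HE.
have D a : is_diff x (fun y => H ('d f y a) (f y))
   (fun b => \sum_j (('d f x a) 0 j *: 'd (H (delta_mx 0 j)) (f x) ('d f x b) +
       ('d (fun y => 'd f y a) x b) 0 j *: H (delta_mx 0 j) (f x))).
  rewrite (_ : (fun y => _) =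
      fun y => \sum_j ('d f y a) 0 j *: H (delta_mx 0 j) (f y)); last first.
    by apply/funext => y; rewrite HE.
  apply: is_diff_sum => j; apply: is_diff_scale.
    have [+ _] := fC' a => /(_ x Ux)/differentiableP; exact: is_diff_coord.
  exact: (is_diff_comp fx (differentiableP (HD _))).
split=> [a|a b]; first exact: (@ex_diff _ _ _ _ _ _ _ (D a)).
rewrite (@diff_val _ _ _ _ _ _ _ (D a)) (@diff_val _ _ _ _ _ _ _ (D b)).
rewrite !big_split /=; congr (_ + _).
  have E c d : \sum_j ('d f x c) 0 j *: 'd (H (delta_mx 0 j)) (f x) ('d f x d) =
      'd (H ('d f x c)) (f x) ('d f x d) by rewrite (dH ('d f x c)).
  by rewrite !E Hsym.
apply: eq_bigr => j _; congr (_ *: _).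
have C2 : Ck 2 U (fun y => f y 0 j) by exact: Ck_coord.
have dj y a' : U y -> 'd (fun y => f y 0 j) y a' = ('d f y a') 0 j.
  move=> Uy; have Dj := is_diff_coord j (differentiableP (fD y Uy)).
  by rewrite (@diff_val _ _ _ _ _ _ _ Dj).
have ddj a' b' : 'd (fun y => 'd (fun y => f y 0 j) y a') x b' =
    ('d (fun y => 'd f y a') x b') 0 j.
  have [+ _] := fC' a' => /(_ x Ux)/differentiableP dx.
  have dc := is_diff_coord j dx.
  have -> : 'd (fun y => 'd (fun y => f y 0 j) y a') x =
            'd (fun y => ('d f y a') 0 j) x :> (_ -> _).
    apply: (near_eq_diff _ (@ex_diff _ _ _ _ _ _ _ dc)).2.
    by apply: filterS (open_nbhs_nbhs (conj oU Ux)) => y Uy; rewrite dj.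
  by rewrite (@diff_val _ _ _ _ _ _ _ dc).
by rewrite -!ddj; exact: schwarz C2.
Qed.

End PullbackOneForm.

(** * Charts and differentials of maps between manifolds *)

Lemma diff_comp_near (R : realType) (U V W : normedModType R) (f : U -> V)
    (g : V -> W) (h : U -> W) x y v : f x = y ->
  differentiable f x -> differentiable g y ->
  (\forall u \near x, g (f u) = h u) -> 'd h x v = 'd g y ('d f x v).
Proof.
move=> <- fD gD gfh.
have D := is_diff_comp (differentiableP fD) (differentiableP gD).
rewrite (near_eq_diff gfh (@ex_diff _ _ _ _ _ _ _ D)).2.
by rewrite (@diff_val _ _ _ _ _ _ _ D).
Qed.

Section Charts.
Variable R : realType.

Lemma chart_img_open_sub (T : topologicalType) n (c : chart R T n) (O : set T) :
  open O -> open (c @` (chart_dom c `&` O)).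
Proof.
move=> oO.
have -> : c @` (chart_dom c `&` O) = c @` chart_dom c `&` chart_inv c @^-1` O.
  apply/seteqP; split=> [_ [p [cp Op] <-]|_ [[p cp <-]] /=].
    by split; [exists p|rewrite /= chart_mapK].
  by rewrite chart_mapK// => Op; exists p.
rewrite openE => u [uc uO].
have nc : nbhs u (c @` chart_dom c).
  by apply: open_nbhs_nbhs; split => //; exact: chart_img_open.
have nO : nbhs u (chart_inv c @^-1` O).
  by apply: (chart_inv_continuous uc); exact: open_nbhs_nbhs.
exact: filterI nc nO.
Qed.

Lemma near_chart_inv (T : topologicalType) n (c : chart R T n) p (O : set T) :
  chart_dom c p -> nbhs p O -> \forall u \near c p, O (chart_inv c u).
Proof.
move=> cp Op; have cc : (c @` chart_dom c) (c p) by exists p.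
by apply: (chart_inv_continuous cc); rewrite chart_mapK.
Qed.

Variables (n k : nat) (N : manifold R n) (M : manifold R k).
Variables (F : N -> M) (Fs : smooth_map F).

Lemma smooth_map_dom_open (c : chart R N n) (d : chart R M k) :
  open (c @` (chart_dom c `&` F @^-1` chart_dom d)).
Proof.
apply: chart_img_open_sub; case: Fs => Fc _.
by apply: open_comp (@chart_dom_open _ _ _ d) => x _; exact: Fc.
Qed.

Lemma smooth_map_diff c d p : atlas N c -> atlas M d -> chart_dom c p ->
  chart_dom d (F p) -> differentiable (d \o F \o chart_inv c) (c p).
Proof.
move=> ac ad cp dp; case: Fs => _ /(_ c d ac ad 1%N)[+ _]; apply; by exists p.
Qed.

Lemma id_smooth : smooth_map (@id N).
Proof. by split=> [x|c d ac ad]; [exact: cvg_id|exact: chart_transition]. Qed.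

End Charts.

Section ChartChange.
Variables (R : realType).

Lemma transition_diff n (N : manifold R n) c c' p : atlas N c -> atlas N c' -> chart_dom c p ->
  chart_dom c' p -> differentiable (c' \o chart_inv c) (c p).
Proof. exact: (@smooth_map_diff _ _ _ _ _ _ (id_smooth N)). Qed.

Lemma diff_self_transition n (N : manifold R n) (c : chart R N n) p v :
  atlas N c -> chart_dom c p ->
  'd (c \o chart_inv c) (c p) v = v.
Proof.
move=> ac cp; have E : \forall u \near c p, id u = (c \o chart_inv c) u.
  have cc : (c @` chart_dom c) (c p) by exists p.
  have nc := open_nbhs_nbhs (conj (@chart_img_open _ _ _ c) cc).
  by apply: filterS nc => _ [q cq <-]; rewrite /= chart_mapK.
rewrite (near_eq_diff E _).2; last exact: (@ex_diff _ _ _ _ _ _ _ (is_diff_id _)).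
by rewrite diff_val.
Qed.

Variables (n k : nat) (N : manifold R n) (M : manifold R k).
Variables (F : N -> M) (Fs : smooth_map F).

Lemma diff_change_target c d d' p v : atlas N c -> atlas M d -> atlas M d' ->
  chart_dom c p -> chart_dom d (F p) -> chart_dom d' (F p) ->
  'd (d' \o F \o chart_inv c) (c p) v =
  'd (d' \o chart_inv d) (d (F p)) ('d (d \o F \o chart_inv c) (c p) v).
Proof.
move=> ac ad ad' cp dp dp'.
apply: (@diff_comp_near _ _ _ _ (d \o F \o chart_inv c) (d' \o chart_inv d)).
- by rewrite /= chart_mapK.
- exact: smooth_map_diff.
- exact: transition_diff ad ad' dp dp'.
have nO : nbhs p (F @^-1` chart_dom d).
  by case: Fs => /(_ p) + _; apply; apply: open_nbhs_nbhs; split=> //; exact: chart_dom_open.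
by apply: filterS (near_chart_inv cp nO) => u /= du; rewrite chart_mapK.
Qed.

Lemma diff_change_source c c' d p v : atlas N c -> atlas N c' -> atlas M d ->
  chart_dom c p -> chart_dom c' p -> chart_dom d (F p) ->
  'd (d \o F \o chart_inv c') (c' p) ('d (c' \o chart_inv c) (c p) v) =
  'd (d \o F \o chart_inv c) (c p) v.
Proof.
move=> ac ac' ad cp cp' dp.
apply/esym.
apply: (@diff_comp_near _ _ _ _ (c' \o chart_inv c) (d \o F \o chart_inv c')).
- by rewrite /= chart_mapK.
- exact: transition_diff.
- exact: smooth_map_diff.
have nO := open_nbhs_nbhs (conj (@chart_dom_open _ _ _ c') cp').
by apply: filterS (near_chart_inv cp nO) => u /= du; rewrite chart_mapK.
Qed.

End ChartChange.

(** * Coordinate vector fields and closedness of parallel one-forms *)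

Section CoordinateFields.
Variables (R : realType).

(** The vector field with constant components [v] in the chart [c]; its value at
    [q] has to be given by components in [chart_at q]. *)
Definition coord_field n (M : manifold R n) (c : chart R M n) (v : 'rV[R]_n)
    (q : M) : 'rV[R]_n :=
  v *m jacobian (chart_at q \o chart_inv c) (c q).

Lemma coord_fieldE n (M : manifold R n) (c : chart R M n) v q :
  coord_field c v q = 'd (chart_at q \o chart_inv c) (c q) v.
Proof. by rewrite /coord_field /jacobian mul_rV_lin1. Qed.

Section One.
Variables (n : nat) (M : manifold R n).
Implicit Types c d : chart R M n.

Lemma coord_field_center (p : M) v : coord_field (chart_at p) v p = v.
Proof.
rewrite coord_fieldE diff_self_transition//; [exact: chart_at_atlas|exact: chart_at_dom].
Qed.

Lemma chart_coord_field c d q v : atlas M c -> atlas M d ->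
  chart_dom c q -> chart_dom d q ->
  chart_coord d q (coord_field c v q) = 'd (d \o chart_inv c) (c q) v.
Proof.
move=> ac ad cq dq; rewrite /chart_coord /jacobian mul_rV_lin1 coord_fieldE.
exact: (@diff_change_source _ _ _ M M id (id_smooth M) c (chart_at q) d q v ac
  (chart_at_atlas q) ad cq (chart_at_dom q) dq).
Qed.

(** In another chart [d], the field has components the derivative along [v] of
    the transition map d o c^-1, composed with c o d^-1. *)
Lemma coord_field_smooth c v : atlas M c ->
  smooth_field (chart_dom c) (coord_field c v).
Proof.
move=> ac d ad l.
pose U' := c @` (chart_dom c `&` chart_dom d).
have oU' : open U' by exact: chart_img_open_sub (@chart_dom_open _ _ _ d).
have oU : open (d @` (chart_dom d `&` chart_dom c)).
  exact: chart_img_open_sub (@chart_dom_open _ _ _ c).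
rewrite setIC.
apply: (@Ck_ext _ _ _ _ _ ((fun z => 'd (d \o chart_inv c) z v) \o (c \o chart_inv d))) => //.
  move=> _ [q [dq cq] <-]; rewrite /chart_field /= chart_mapK//.
  by rewrite chart_coord_field.
apply: (@Ck_comp _ _ _ _ _ _ U') => //.
- by move=> _ [q [dq cq] <-]; exists q; rewrite /= ?chart_mapK.
- exact: chart_transition.
- by have [_ /(_ v)] := @chart_transition _ _ M c d ac ad l.+1.
Qed.

Lemma coord_field_bracket (p : M) v w :
  lie_bracket (coord_field (chart_at p) v) (coord_field (chart_at p) w) p = 0.
Proof.
set c := chart_at p; rewrite /lie_bracket -/c.
have ac : atlas M c by exact: chart_at_atlas.
have cp : chart_dom c p by exact: chart_at_dom.
have K u x : 'd (chart_field c (coord_field c u)) (c p) x = 0.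
  suff E : \forall z \near c p, cst u z = chart_field c (coord_field c u) z.
    by rewrite (near_eq_diff E (differentiable_cst u (c p))).2 diff_cst.
  have cc : (c @` chart_dom c) (c p) by exists p.
  have nc := open_nbhs_nbhs (conj (@chart_img_open _ _ _ c) cc).
  apply: filterS nc => _ [q cq <-]; rewrite /chart_field chart_mapK//.
  by rewrite chart_coord_field// diff_self_transition.
by apply: etrans (congr2 (fun a b => a - b) (K w _) (K v _)) _; rewrite subrr.
Qed.

Definition coord_oneform (eta : M -> 'cV[R]_n) c (v z : 'rV[R]_n) : R :=
  covec (eta (chart_inv c z)) (coord_field c v (chart_inv c z)).

Lemma coord_oneform_sum eta c v z : coord_oneform eta c v z =
  \sum_j v 0 j *: coord_oneform eta c (delta_mx 0 j) z.
Proof.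
rewrite /coord_oneform /covec /coord_field [in LHS](row_sum_delta v).
rewrite !mulmx_suml summxE; apply: eq_bigr => j _.
by rewrite -!scalemxAl mxE.
Qed.

Lemma coord_oneform_diff eta c v q : smooth_oneform eta -> atlas M c ->
  chart_dom c q -> differentiable (coord_oneform eta c v) (c q).
Proof.
move=> etaS ac cq.
have [+ _] := etaS _ _ (@chart_dom_open _ _ _ c) (coord_field_smooth v ac) c ac 1%N.
by apply; exists q.
Qed.

(** For parallel [eta], the derivative of eta(Y) along X is eta(nabla_X Y).
    Coordinate fields X, Y commute, so nabla_X Y = nabla_Y X by vanishing of the
    torsion.  It is enough to work at the centre of the chart chosen at [p],
    where brackets are computed in that very chart. *)
Lemma parallel_oneform_closed (g : M -> 'M[R]_n) nabla eta (p : M) v w :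
  levi_civita g nabla -> smooth_oneform eta -> parallel_oneform nabla eta ->
  'd (coord_oneform eta (chart_at p) v) (chart_at p p) w =
  'd (coord_oneform eta (chart_at p) w) (chart_at p p) v.
Proof.
move=> LC etaS par; set c := chart_at p.
have ac : atlas M c by exact: chart_at_atlas.
have cp : chart_dom c p by exact: chart_at_dom.
have sm u : smooth_field_near p (coord_field c u).
  exists (chart_dom c); last exact: coord_field_smooth.
  by split=> //; exact: chart_dom_open.
have P u u' : 'd (coord_oneform eta c u) (c p) u' =
    covec (eta p) (nabla p u' (coord_field c u)).
  by have /eqP := par p u' _ (sm u); rewrite subr_eq0 => /eqP <-.
have T := levi_civita_torsion LC (sm v) (sm w).
rewrite coord_field_bracket !coord_field_center in T.
move/eqP: T; rewrite subr_eq0 => /eqP T.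
by rewrite !P T.
Qed.

End One.

Lemma coord_field_dmap n k (N : manifold R n) (M : manifold R k) (F : N -> M)
    c d p v : smooth_map F -> atlas N c -> atlas M d ->
  chart_dom c p -> chart_dom d (F p) ->
  coord_field c v p *m dmap F p =
  coord_field d ('d (d \o F \o chart_inv c) (c p) v) (F p).
Proof.
move=> Fs ac ad cp dp; rewrite /dmap /jacobian mul_rV_lin1 !coord_fieldE.
apply: etrans (diff_change_source Fs v ac (chart_at_atlas p) (chart_at_atlas (F p))
  cp (chart_at_dom p) (chart_at_dom (F p))) _.
exact: (diff_change_target Fs v ac ad (chart_at_atlas (F p)) cp dp (chart_at_dom (F p))).
Qed.

End CoordinateFields.

(** * Slices of a map defined on a product *)

Lemma locally_constant_connected (T : topologicalType) (A : Type) (f : T -> A) :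
  connected [set: T] -> (forall x, \forall y \near x, f y = f x) ->
  forall x y, f x = f y.
Proof.
move=> cT fl x y.
have lo (P : A -> Prop) : open [set z | P (f z)].
  rewrite openE => z /= Pz; have /= := fl z.
  by apply: filterS => t /= ->.
have S : [set z | f z = f y] = setT.
  apply: cT; first by exists y.
    by exists [set z | f z = f y]; [exact: (lo (fun a => a = f y))|rewrite setTI].
  exists [set z | f z = f y]; last by rewrite setTI.
  rewrite -[X in closed X]setCK; apply: open_closedC.
  exact: (lo (fun a => a <> f y)).
by have : [set z | f z = f y] x by rewrite S.
Qed.

Section Slices.
Variables (R : realType).

Lemma is_diff_row_mxl n1 n2 (u : 'rV[R]_n1) (w : 'rV[R]_n2) :
  is_diff u (fun u : 'rV[R]_n1 => row_mx u w) (fun v => row_mx v 0).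
Proof.
have -> : (fun u : 'rV[R]_n1 => row_mx u w) =
   (fun u => u *m row_mx 1%:M 0) + cst (w *m row_mx 0 1%:M).
  by apply/funext => v; rewrite row_mxE.
have -> : (fun v : 'rV[R]_n1 => row_mx v (0 : 'rV[R]_n2)) =
   (fun u => u *m row_mx 1%:M 0) + 0.
  by apply/funext => v; rewrite row_mxE mul0mx.
have D := mulmxr_is_diff (row_mx 1%:M (0 : 'M[R]_(n1, n2))) u.
exact: is_diffD.
Qed.

Lemma is_diff_row_mxr n1 n2 (u : 'rV[R]_n1) (w : 'rV[R]_n2) :
  is_diff w (fun w : 'rV[R]_n2 => row_mx u w) (fun v => row_mx 0 v).
Proof.
have -> : (fun w : 'rV[R]_n2 => row_mx u w) =
   cst (u *m row_mx 1%:M 0) + (fun w => w *m row_mx 0 1%:M).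
  by apply/funext => v; rewrite row_mxE.
have -> : (fun v : 'rV[R]_n2 => row_mx (0 : 'rV[R]_n1) v) =
   0 + (fun w => w *m row_mx 0 1%:M).
  by apply/funext => v; rewrite row_mxE mul0mx.
have D := mulmxr_is_diff (row_mx (0 : 'M[R]_(n2, n1)) 1%:M) w.
exact: is_diffD.
Qed.

Variables (b k n : nat) (B : manifold R b) (F : manifold R k) (M : manifold R n).
Variables (iota : prod_manifold B F -> M) (iotaS : smooth_map iota).

Lemma prod_chart_atlas c e : atlas B c -> atlas F e ->
  atlas (prod_manifold B F) (prod_chart c e).
Proof. by move=> ac ae; exists c => //; exists e. Qed.

Lemma base_slice_diff c e d y x v : atlas B c -> atlas F e -> atlas M d ->
  chart_dom c y -> chart_dom e x -> chart_dom d (iota (y, x)) ->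
  'd (d \o (fun y => iota (y, x)) \o chart_inv c) (c y) v =
  'd (d \o iota \o chart_inv (prod_chart c e)) (row_mx (c y) (e x)) (row_mx v 0).
Proof.
move=> ac ae ad cy ex dyx.
have D := is_diff_row_mxl (c y) (e x).
have E : 'd (fun u => row_mx u (e x)) (c y) v = row_mx v 0.
  by rewrite (@diff_val _ _ _ _ _ _ _ D).
rewrite -E; apply: (@diff_comp_near _ _ _ _ (fun u => row_mx u (e x))
  (d \o iota \o chart_inv (prod_chart c e))) => //.
- exact: (smooth_map_diff (p := (y, x)) iotaS (prod_chart_atlas ac ae) ad).
- by near=> u; rewrite /= row_mxKl row_mxKr chart_mapK.
Unshelve. all: by end_near. Qed.

Lemma fibre_slice_diff c e d y x v : atlas B c -> atlas F e -> atlas M d ->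
  chart_dom c y -> chart_dom e x -> chart_dom d (iota (y, x)) ->
  'd (d \o (fun x => iota (y, x)) \o chart_inv e) (e x) v =
  'd (d \o iota \o chart_inv (prod_chart c e)) (row_mx (c y) (e x)) (row_mx 0 v).
Proof.
move=> ac ae ad cy ex dyx.
have D := is_diff_row_mxr (c y) (e x).
have E : 'd (fun u => row_mx (c y) u) (e x) v = row_mx 0 v.
  by rewrite (@diff_val _ _ _ _ _ _ _ D).
rewrite -E; apply: (@diff_comp_near _ _ _ _ (fun u => row_mx (c y) u)
  (d \o iota \o chart_inv (prod_chart c e))) => //.
- exact: (smooth_map_diff (p := (y, x)) iotaS (prod_chart_atlas ac ae) ad).
- by near=> u; rewrite /= row_mxKl row_mxKr chart_mapK.
Unshelve. all: by end_near. Qed.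

Lemma dmap_fibre_slice y x :
  dmap (fun x => iota (y, x)) x = row_mx 0 1%:M *m dmap iota (y, x).
Proof.
apply/row_matrixP => i; rewrite !rowE mulmxA mul_mx_row mulmx0 mulmx1.
rewrite /dmap /jacobian !mul_rV_lin1.
exact: (fibre_slice_diff (delta_mx 0 i) (chart_at_atlas y) (chart_at_atlas x)
  (chart_at_atlas (iota (y, x))) (chart_at_dom y) (chart_at_dom x)
  (chart_at_dom (iota (y, x)))).
Qed.

Hypothesis base_slice_smooth : forall x, smooth_map (fun y : B => iota (y, x)).
Hypothesis fibre_slice_smooth : forall y, smooth_map (fun x : F => iota (y, x)).

Variable eta : M -> 'cV[R]_n.
Hypothesis etaS : smooth_oneform eta.
Hypothesis eta_closed : forall p v w,
  'd (coord_oneform eta (chart_at p) v) (chart_at p p) w =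
  'd (coord_oneform eta (chart_at p) w) (chart_at p p) v.
Hypothesis eta_base : forall y x v,
  covec (eta (iota (y, x))) (v *m dmap (fun y : B => iota (y, x)) y) = 0.

(** The pullback of [eta] is closed and has no base component [beta (row_mx v 0)];
    hence the derivative of a fibre component [beta (row_mx 0 w)] along a base
    direction equals a derivative of zero.  This is done at every point [y1] of
    the chart domain, each time with the target chart centred at
    [iota (y1, x0)], since [eta_closed] speaks of chart centres only. *)
Lemma fibre_pullback_locally_constant x0 w y0 : \forall y \near y0,
  covec (eta (iota (y, x0))) (w *m dmap (fun x : F => iota (y, x)) x0) =
  covec (eta (iota (y0, x0))) (w *m dmap (fun x : F => iota (y0, x)) x0).
Proof.
pose A y := covec (eta (iota (y, x0))) (w *m dmap (fun x => iota (y, x)) x0).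
rewrite -[X in \forall y \near y0, _ = X]/(A y0); change (\forall y \near y0, A y = A y0).
pose c := chart_at y0; pose e := chart_at x0.
have ac : atlas B c by exact: chart_at_atlas.
have ae : atlas F e by exact: chart_at_atlas.
have cy0 : chart_dom c y0 by exact: chart_at_dom.
have ex0 : chart_dom e x0 by exact: chart_at_dom.
pose h u := A (chart_inv c u).
have key y1 : chart_dom c y1 ->
    differentiable h (c y1) /\ forall v, 'd h (c y1) v = 0.
  move=> cy1; pose d := chart_at (iota (y1, x0)).
  have ad : atlas M d by exact: chart_at_atlas.
  have dy1 : chart_dom d (iota (y1, x0)) by exact: chart_at_dom.
  pose PC : chart R (prod_manifold B F) (b + k) := prod_chart c e.
  have aPC : atlas (prod_manifold B F) PC by exact: prod_chart_atlas.
  pose Phi := d \o iota \o chart_inv PC.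
  pose U := PC @` (chart_dom PC `&` iota @^-1` chart_dom d).
  have oU : open U by exact: smooth_map_dom_open.
  pose z1 := row_mx (c y1) (e x0).
  have Uz1 : U z1 by exists (y1, x0).
  have PhiC : Ck 2 U Phi by case: iotaS => _ /(_ PC d aPC ad 2%N).
  have Phiz1 : Phi z1 = d (iota (y1, x0)).
    by rewrite /Phi /= row_mxKl row_mxKr !chart_mapK.
  have [|||bD bsym] := @pullback_closed _ _ _ U Phi (coord_oneform eta d) z1 oU Uz1 PhiC.
  - exact: coord_oneform_sum.
  - by move=> v; rewrite Phiz1; exact: coord_oneform_diff.
  - by move=> v v'; rewrite Phiz1; exact: eta_closed.
  pose beta a z := coord_oneform eta d ('d Phi z a) (Phi z).
  have betaB v z : U z -> beta (row_mx v 0) z = 0.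
    move=> [[y x] [[/= cy ex] dyx] <-].
    rewrite /beta -(eta_base y x (coord_field c v y)).
    rewrite (coord_field_dmap v (base_slice_smooth x) ac ad cy dyx).
    rewrite (base_slice_diff v ac ae ad cy ex dyx).
    by rewrite /coord_oneform /Phi /= row_mxKl row_mxKr !chart_mapK.
  have betaF y : chart_dom c y -> chart_dom d (iota (y, x0)) ->
      beta (row_mx 0 w) (row_mx (c y) (e x0)) = A y.
    move=> cy dyx; rewrite /beta /A -[in RHS](coord_field_center x0 w) -/e.
    rewrite (coord_field_dmap w (fibre_slice_smooth y) ae ad ex0 dyx).
    rewrite (fibre_slice_diff w ac ae ad cy ex0 dyx).
    by rewrite /coord_oneform /Phi /= row_mxKl row_mxKr !chart_mapK.
  have D := is_diff_row_mxl (c y1) (e x0).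
  have hE : \forall u \near c y1, (beta (row_mx 0 w) \o (fun u => row_mx u (e x0))) u = h u.
    have oO : open (c @` (chart_dom c `&` (fun y => iota (y, x0)) @^-1` chart_dom d)).
      exact: smooth_map_dom_open.
    have O1 : (c @` (chart_dom c `&` (fun y => iota (y, x0)) @^-1` chart_dom d)) (c y1).
      by exists y1.
    apply: filterS (open_nbhs_nbhs (conj oO O1)) => _ [y [cy dy] <-].
    change (beta (row_mx 0 w) (row_mx (c y) (e x0)) = A (chart_inv c (c y))).
    by rewrite (chart_mapK cy); exact: betaF.
  have Dh := is_diff_comp D (differentiableP (bD (row_mx 0 w))).
  have [hD hd] := near_eq_diff hE (@ex_diff _ _ _ _ _ _ _ Dh).
  split=> // v; rewrite hd (@diff_val _ _ _ _ _ _ _ Dh) /= bsym.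
  have bE : \forall z \near z1, cst 0 z = beta (row_mx v 0) z.
    by apply: filterS (open_nbhs_nbhs (conj oU Uz1)) => z /betaB ->.
  by rewrite (near_eq_diff bE (differentiable_cst (0 : R) z1)).2 diff_cst.
have oc := @chart_img_open _ _ _ c.
have H : \forall u \near c y0, h u = h (c y0).
  apply: (constant_of_diff0 (U := c @` chart_dom c)) => //.
  - by move=> _ [y cy <-]; have [hD _] := key y cy; exact: hD.
  - by move=> z v [y cy <-]; have [_ h0] := key y cy; exact: h0.
have {}H : \forall y \near y0, h (c y) = h (c y0).
  exact: (chart_map_continuous cy0 H).
have nc := open_nbhs_nbhs (conj (@chart_dom_open _ _ _ c) cy0).
by apply: filterS2 H nc => y + cy; rewrite /h !chart_mapK.
Qed.

End Slices.

(** * Constancy of the warping function *)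

Section Paracontact.
Variables (R : realType) (m : nat) (M : manifold R m.*2.+1).
Variable S : lorentzian_almost_paracontact M.

(** Compatibility of the metric with phi, applied to [u] and xi: phi xi = 0. *)
Lemma eta_metric p u : covec (eta S p) u = Defs.form (metric S p) u (xi S p).
Proof.
have := metric_phi S p u (xi S p); rewrite phi_xi eta_xi mulrN1.
by rewrite {1}/Defs.form trmx0 mulmx0 mxE => /esym/eqP; rewrite subr_eq0 => /eqP.
Qed.

End Paracontact.

Theorem proposition4p2 (R : realType) (m : nat) (Mbar : manifold R m.*2.+1)
    (S : lorentzian_almost_paracontact Mbar)
    (Spc : lorentzian_paracosymplectic S) :
  ~ exists (b k : nat) (B : manifold R b) (F : manifold R k)
      (gB : B -> 'M[R]_b) (gF : F -> 'M[R]_k) (f : B -> R)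
      (iota : prod_manifold B F -> Mbar)
      (DT Dth : prod_manifold B F -> 'M[R]_(b + k))
      (theta : prod_manifold B F -> R),
      semi_slant_warped_product_xi_tangent_fibre S gB gF f iota DT Dth theta /\
      nontrivial_warping f.
Proof.
case: Spc => nabla LC [par _].
move=> [b [k [B [F [gB [gF [f [iota [DT [Dth [theta [W]]]]]]]]]]]]; apply.
have [iotaND _ split_TN _ _] := total_semi_slant W.
have iotaS : smooth_map iota := iotaND.1.1.
have [x0 _] := @manifold_nonempty _ _ F.
(* the base leaves are tangent to [DT], which is orthogonal to xi *)
have eta_base y x v :
    covec (eta S (iota (y, x))) (v *m dmap (fun y : B => iota (y, x)) y) = 0.
  have [_ _ _ + _] := split_TN (y, x); rewrite /orthogonal => Txi.
  have /andP[dT _] := base_integral W y x.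
  have /submxP[w ->] := submx_trans (submxMl v _) dT.
  by rewrite eta_metric /Defs.form -2!(mulmxA w) Txi mulmx0 mxE.
(* the components at [x0] of the pullback of eta to the fibre over [y] *)
pose a y : 'cV[R]_k := dmap (fun x : F => iota (y, x)) x0 *m eta S (iota (y, x0)).
have aj y j : a y j 0 =
    covec (eta S (iota (y, x0))) (delta_mx 0 j *m dmap (fun x : F => iota (y, x)) x0).
  by rewrite /covec -mulmxA -rowE [RHS]mxE.
have a_loc y0 : \forall y \near y0, a y = a y0.
  have L j := fibre_pullback_locally_constant iotaS (fun x => (base_invariant W x).1.1.1)
    (fun y => (fibre_proper_slant W y).1.1.1.1) (@eta_smooth _ _ _ S)
    (fun p v w => parallel_oneform_closed p v w LC (@eta_smooth _ _ _ S) par)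
    eta_base x0 (delta_mx 0 j) y0.
  have {}L := filter_forall (nbhs_filter y0) L.
  apply: (@filterS _ _ (nbhs_filter y0) _ _ _ L) => y E; apply/colP => j.
  exact: etrans (etrans (aj y j) (E j)) (esym (aj y0 j)).
(* With z the components of xi along the fibre, a = f^2 gF z^T, and pairing
   with z gives -1 = eta(xi) = z a = f^-2 a^T gF^-T a. *)
have fE y : f y ^+ 2 = - ((a y)^T *m (invmx (gF x0))^T *m a y) 0 0.
  set dx := dmap (fun x : F => iota (y, x)) x0.
  have /submxP[z zE] := xi_tangent_fibre W y x0; rewrite -/dx in zE.
  have gE : dx *m metric S (iota (y, x0)) *m dx^T = f y ^+ 2 *: gF x0.
    have := total_metric W (y, x0); rewrite /pullback /warped_metric /= => E.
    rewrite /dx dmap_fibre_slice// trmx_mul tr_row_mx trmx0 trmx1.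
    have -> : row_mx 0 1%:M *m dmap iota (y, x0) *m metric S (iota (y, x0)) *m
       ((dmap iota (y, x0))^T *m col_mx 0 1%:M) = row_mx 0 1%:M *m
       (dmap iota (y, x0) *m metric S (iota (y, x0)) *m (dmap iota (y, x0))^T) *m
       col_mx 0 1%:M by rewrite !mulmxA.
    rewrite E mul_row_block !mul0mx !mul1mx !add0r.
    by rewrite mul_row_col mulmx0 add0r mulmx1.
  have etaE : eta S (iota (y, x0)) = metric S (iota (y, x0)) *m (xi S (iota (y, x0)))^T.
    apply/colP => j; have := eta_metric S (iota (y, x0)) (delta_mx 0 j).
    by rewrite /covec /Defs.form -mulmxA -!rowE !mxE.
  have aE : a y = f y ^+ 2 *: (gF x0 *m z^T).
    by rewrite /a -/dx etaE zE trmx_mul !mulmxA gE scalemxAl.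
  have [_ /(_ x0)[gT gU]] := fibre_metric W.
  have f0 : f y ^+ 2 != 0 by rewrite expf_neq0// gt_eqF// (warping_gt0 W).
  have zT : z^T = (f y ^+ 2)^-1 *: (invmx (gF x0) *m a y).
    by rewrite aE -scalemxAr scalerA mulVf// scale1r mulKmx.
  have E : (z *m a y) 0 0 = -1 by rewrite /a -/dx mulmxA -zE; exact: eta_xi.
  rewrite -[z]trmxK zT linearZ /= trmx_mul -scalemxAl mxE in E.
  by apply: (mulfI (invr_neq0 f0)); rewrite mulrN E opprK mulVf.
have [y0 _] := @manifold_nonempty _ _ B.
exists (f y0) => y; apply: (locally_constant_connected (base_connected W)) => {y0 y} y0.
apply: filterS (a_loc y0) => y E.
have : f y ^+ 2 = f y0 ^+ 2 by rewrite !fE E.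
by move/eqP; rewrite eqrXn2// ?ltW// ?(warping_gt0 W)// => /eqP.
Qed.
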